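(* Let $\mathcal N$ be an admissible algebra and $\pi\in\Pi(\mathcal N)$. Then the mappings $$\alpha_\pi:S_\pi\to\Pi(\mathcal N),\quad s\mapsto\pi\circ M_{\exp s},\qquad\text{and}\qquad \beta:\Pi(\mathcal N)\to\Sigma(\mathcal N),\quad \rho\mapsto S_\rho,$$ are bijective and satisfy $\beta\circ\alpha_\pi(s)=S_\pi-s$ for all $s\in S_\pi$.
   Context: $\mathbb F$ is a field of characteristic $0$; all algebras are associative $\mathbb F$-algebras. An admissible algebra is a commutative nilpotent algebra $\mathcal N$ of finite dimension over $\mathbb F$ whose annihilator $\mathcal N_{[1]}=\{x\in\mathcal N:x\mathcal N=0\}$ has dimension $1$. $\Pi(\mathcal N)$ is the set of all admissible projections, i.e. linear maps $\pi=\pi^2\in\mathrm{End}(\mathcal N)$ with range $\mathcal N_{[1]}$. Put $\exp_1(x)=\sum_{k\ge1}x^k/k!$ for $x\in\mathcal N$, $S_\pi:=\{x\in\mathcal N:\pi(\exp_1x)=0\}$ and $\Sigma(\mathcal N):=\{S_\pi:\pi\in\Pi(\mathcal N)\}$. $\mathcal N^0=\mathbb F\cdot\mathbf 1\oplus\mathcal N$ is the unital extension, $\exp(x)=\mathbf 1+\exp_1(x)\in\mathcal N^0$, and for $e\in\mathcal N^0$, $M_e\in\mathrm{End}(\mathcal N)$ is $M_e(x)=ex$. $S_\pi-s=\{x-s:x\in S_\pi\}$. *)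

(* Defs.v *)
From HB Require Import structures.
From mathcomp Require Import all_boot all_order all_algebra.
From mathcomp Require Import mathcomp_extra boolp classical_sets functions.

Set Implicit Arguments.
Unset Strict Implicit.
Unset Printing Implicit Defensive.

Import GRing.Theory.

Local Open Scope ring_scope.

(* Finite-dimensional associative algebras, not necessarily unital: the ring
   structures of ssralg all have a unit, which a nonzero nilpotent algebra
   cannot have. *)
HB.mixin Record Vector_isAssocAlgebra (F : fieldType) N of Vector F N := {
  nmul : N -> N -> N;
  nmulA : associative nmul;
  nmulDl : left_distributive nmul +%R;
  nmulDr : right_distributive nmul +%R;
  nscaleAl : forall (a : F) (x y : N), a *: nmul x y = nmul (a *: x) y;
  nscaleAr : forall (a : F) (x y : N), a *: nmul x y = nmul x (a *: y)
}.

#[short(type="assocAlgType")]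
HB.structure Definition AssocAlgebra (F : fieldType) :=
  {N of Vector_isAssocAlgebra F N & Vector F N}.

Section AssocAlgebraTheory.
Variables (F : fieldType) (N : assocAlgType F).
Implicit Types x y : N.

Lemma nmul_is_linear x : linear (nmul x).
Proof. by move=> a u v; rewrite nmulDr nscaleAr. Qed.

HB.instance Definition _ x :=
  GRing.isLinear.Build F N N *:%R (nmul x) (nmul_is_linear x).

Definition lmult x : 'End(N) := linfun (nmul x).

Lemma lmultE x y : lmult x y = nmul x y.
Proof. by rewrite lfunE. Qed.

Lemma lmult_is_linear : linear lmult.
Proof.
move=> a u v; apply/lfunP => y.
by rewrite add_lfunE scale_lfunE !lmultE nmulDl nscaleAl.
Qed.

HB.instance Definition _ :=
  GRing.isLinear.Build F N 'End(N) *:%R lmult lmult_is_linear.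

Definition annihilator : {vspace N} := lker (linfun lmult).

Lemma annihilatorP x :
  reflect (forall y, nmul x y = 0) (x \in annihilator).
Proof.
rewrite memv_ker lfunE /=; apply: (iffP eqP) => [x0 y | x0].
  by rewrite -lmultE x0 lfunE.
by apply/lfunP => y; rewrite lmultE x0 lfunE.
Qed.

(* Some n is such that all products of n + 1 elements vanish. *)
Definition nilpotent_alg : Prop :=
  exists n, forall (x : N) (s : seq N), size s = n -> foldl nmul x s = 0.

(* x ^ k, meaningful for k >= 1 only. *)
Definition npow x (k : nat) : N := iter k.-1 (nmul x) x.

End AssocAlgebraTheory.

Arguments annihilator {F} N.
Arguments nilpotent_alg {F} N.

HB.mixin Record AssocAlgebra_isAdmissible (F : fieldType) N
    of AssocAlgebra F N := {
  nmulC : commutative (@nmul F N);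
  nilpotentN : nilpotent_alg N;
  dim_annihilator : \dim (annihilator N) = 1%N
}.

#[short(type="admissibleAlgType")]
HB.structure Definition AdmissibleAlgebra (F : fieldType) :=
  {N of AssocAlgebra_isAdmissible F N & AssocAlgebra F N}.

(* The unital extension F.1 (+) N, the pair (a, x) standing for a.1 + x. *)
Definition unitalExt (F : fieldType) (N : assocAlgType F) : Type :=
  (F^o * N)%type.

Section UnitalExt.
Variables (F : fieldType) (N : assocAlgType F).
Local Notation N0 := (unitalExt N).

HB.instance Definition _ := Vector.copy N0 (F^o * N)%type.

Definition ue_one : N0 := (1, 0).
Definition ue_mul (e f : N0) : N0 :=
  ((e.1 : F) * f.1, (e.1 : F) *: f.2 + (f.1 : F) *: e.2 + nmul e.2 f.2).

Lemma nmul0 (x : N) : nmul x 0 = 0.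
Proof. exact: linear0. Qed.

Lemma nmul0l (x : N) : nmul 0 x = 0.
Proof. by rewrite -lmultE linear0 lfunE. Qed.

Fact ue_mulA : associative ue_mul.
Proof.
move=> [a x] [b y] [c z]; rewrite /ue_mul /=; congr (_, _).
  by rewrite mulrA.
rewrite !scalerDr !nmulDl !nmulDr -!nscaleAl -!nscaleAr !scalerA nmulA.
rewrite (mulrC c a) (mulrC c b) -!addrA; congr (_ + (_ + _)).
rewrite addrCA; congr (_ + _).
by rewrite [RHS]addrCA; congr (_ + _); rewrite addrCA.
Qed.

Fact ue_mul1l : left_id ue_one ue_mul.
Proof.
by move=> [a x]; rewrite /ue_mul /= mul1r scale1r scaler0 nmul0l !addr0.
Qed.

Fact ue_mul1r : right_id ue_one ue_mul.
Proof.
by move=> [a x]; rewrite /ue_mul /= mulr1 scale1r scaler0 nmul0 addr0 add0r.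
Qed.

Fact ue_mulDl : left_distributive ue_mul +%R.
Proof.
move=> [a x] [b y] [c z]; rewrite /ue_mul /=; congr (_, _).
  by rewrite mulrDl.
by rewrite nmulDl scalerDl scalerDr [RHS]addrACA; congr (_ + _); rewrite addrACA.
Qed.

Fact ue_mulDr : right_distributive ue_mul +%R.
Proof.
move=> [a x] [b y] [c z]; rewrite /ue_mul /=; congr (_, _).
  by rewrite mulrDr.
by rewrite nmulDr scalerDl scalerDr [RHS]addrACA; congr (_ + _); rewrite addrACA.
Qed.

Fact ue_one_neq0 : ue_one != 0.
Proof. by rewrite xpair_eqE negb_and oner_eq0. Qed.

HB.instance Definition _ := GRing.Zmodule_isNzRing.Build N0
  ue_mulA ue_mul1l ue_mul1r ue_mulDl ue_mulDr ue_one_neq0.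

Fact ue_scalerAl (a : F) (e f : N0) : a *: (e * f) = (a *: e) * f.
Proof.
case: e f => [b x] [c y]; congr (_, _); rewrite /= ?scalerAl //.
by rewrite !scalerDr nscaleAl !scalerA (mulrC c).
Qed.

HB.instance Definition _ := GRing.Lmodule_isLalgebra.Build F N0 ue_scalerAl.

Fact ue_scalerAr (a : F) (e f : N0) : a *: (e * f) = e * (a *: f).
Proof.
case: e f => [b x] [c y]; congr (_, _); rewrite /= ?scalerAr //.
by rewrite !scalerDr nscaleAr !scalerA (mulrC b).
Qed.

HB.instance Definition _ := GRing.Lalgebra_isAlgebra.Build F N0 ue_scalerAr.

Definition ue_inj (x : N) : N0 := (0, x).

Lemma ue_injM x y : ue_inj (nmul x y) = ue_inj x * ue_inj y.
Proof. by congr (_, _); rewrite /= ?mulr0 // !scale0r !add0r. Qed.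

(* N is an ideal of N0, so that the N-component below is all of e * x; see
   ue_inj_mult. *)
Definition ue_mult_fun (e : N0) (x : N) : N := (e * ue_inj x).2.

Lemma ue_mult_funE e x : ue_mult_fun e x = (e.1 : F) *: x + nmul e.2 x.
Proof. by rewrite /ue_mult_fun /= scale0r addr0. Qed.

Fact ue_mult_is_linear e : linear (ue_mult_fun e).
Proof.
move=> a u v; rewrite !ue_mult_funE nmulDr -nscaleAr !scalerDr !scalerA.
by rewrite (mulrC a) addrACA.
Qed.

HB.instance Definition _ e :=
  GRing.isLinear.Build F N N *:%R (ue_mult_fun e) (ue_mult_is_linear e).

Definition ue_mult (e : N0) : 'End(N) := linfun (ue_mult_fun e).

Lemma ue_inj_mult e x : ue_inj (ue_mult e x) = e * ue_inj x.
Proof. by rewrite lfunE /=; congr (_, _); rewrite mulr0. Qed.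

End UnitalExt.

Section Admissible.
Variables (F : fieldType) (N : admissibleAlgType F).
Implicit Types (x s : N) (k : nat) (pi : 'End(N)).

Lemma npow_eventually0 x : exists k, (0 < k)%N && (npow x k == 0).
Proof.
have [n n0] := nilpotentN (s := N); exists n.+1; apply/eqP.
rewrite -(n0 x (nseq n x)) ?size_nseq // /npow /=.
elim: n {n0} => //= n ->.
elim: n {2 4}x => [|n IH] y /=; first exact: nmulC.
exact: IH.
Qed.

Definition nil_index x : nat := ex_minn (npow_eventually0 x).

(* The series stops at the first vanishing power of x. *)
Definition exp1 x : N :=
  \sum_(1 <= k < nil_index x) (k`!%:R)^-1 *: npow x k.

Lemma npow_eq0 x k : (nil_index x <= k)%N -> npow x k = 0.
Proof.
rewrite /nil_index; case: ex_minnP => -[//|m] /andP[_ /eqP m0] _ /subnK <-.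
rewrite addnS /npow /= iterD [iter m _ _]m0.
by elim: (k - m.+1)%N => //= n ->; exact: nmul0.
Qed.

Lemma exp1E x n : (forall k, (n <= k)%N -> npow x k = 0) ->
  exp1 x = \sum_(1 <= k < n) (k`!%:R)^-1 *: npow x k.
Proof.
move=> n0; rewrite /exp1.
have aux m p : (forall k, (m <= k)%N -> npow x k = 0) ->
  \sum_(1 <= k < m) (k`!%:R)^-1 *: npow x k
  = \sum_(1 <= k < m + p) (k`!%:R)^-1 *: npow x k :> N.
  move=> m0; elim: p => [|p ->]; first by rewrite addn0.
  rewrite addnS; case: (posnP (m + p)) => [->|mp]; first by rewrite !big_geq.
  by rewrite [RHS]big_nat_recr //= m0 ?leq_addr // scaler0 addr0.
by rewrite (aux _ n (@npow_eq0 x)) addnC -aux.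
Qed.

Definition nexp x : unitalExt N := 1 + ue_inj (exp1 x).

Local Open Scope classical_set_scope.

Definition admissible_proj : set 'End(N) :=
  [set pi | (pi \o pi)%VF = pi /\ limg pi = annihilator N].

Definition Spi pi : set N := [set x | pi (exp1 x) = 0].

Definition Sigma : set (set N) := [set Spi pi | pi in admissible_proj].

Definition alpha pi s : 'End(N) := (pi \o ue_mult (nexp s))%VF.

Definition beta pi : set N := Spi pi.

End Admissible.

Arguments admissible_proj {F} N.
Arguments Sigma {F} N.

(* Main.v *)
(* From exp(x + y) = exp(x) exp(y) one gets pi(exp(s) exp1(y)) = pi(exp1(s + y))
   for s in S_pi, which is the identity beta (alpha_pi s) = S_pi - s.  The map
   exp1 is a bijection of N, so alpha_pi amounts to u |-> pi o M_(1 + u) on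
   ker pi: it is injective since every nonzero ideal of N contains the
   annihilator, and surjective by counting dimensions. *)
Require Import Defs.
From HB Require Import structures.
From mathcomp Require Import all_boot all_order all_algebra.
From mathcomp Require Import mathcomp_extra boolp classical_sets functions.

Set Implicit Arguments.
Unset Strict Implicit.
Unset Printing Implicit Defensive.

Import GRing.Theory.

Local Open Scope ring_scope.
Local Open Scope classical_set_scope.

(** * Addition formula for truncated exponential series *)

Section TruncatedExp.
Variables (F : fieldType) (A : algType F).
Implicit Types X Y : A.

Definition exp_trunc (n : nat) X : A :=
  \sum_(0 <= k < n) (k`!%:R : F)^-1 *: X ^+ k.

(** Both sides run over the triangle [i + j < n], by diagonals on the left and by rows on the
    right. *)
Lemma big_nat_triangle (V : nmodType) (f : nat -> nat -> V) n :
  \sum_(0 <= k < n) \sum_(0 <= i < k.+1) f (k - i)%N i =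
  \sum_(0 <= i < n) \sum_(0 <= j < n - i) f j i.
Proof.
elim: n => [|n IH]; first by rewrite !big_geq.
rewrite big_nat_recr //= IH [RHS]big_nat_recr //= subSnn big_nat1.
rewrite [X in _ + X]big_nat_recr //= subnn addrA; congr (_ + _).
rewrite -big_split; apply: eq_big_nat => i /andP[_ lt_in].
by rewrite subSn 1?ltnW // big_nat_recr.
Qed.

(** The binomial formula yields the Cauchy product; characteristic 0 allows division by
    factorials. *)
Lemma exp_truncD n X Y : [pchar F] =i pred0 -> GRing.comm X Y ->
    (forall i j, (n <= i + j)%N -> X ^+ i * Y ^+ j = 0) ->
  exp_trunc n (X + Y) = exp_trunc n X * exp_trunc n Y.
Proof.
move=> char0 cXY XY0.
have fact_neq0 k : (k`!%:R : F) != 0.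
  apply/negP => /(natf0_pchar (fact_gt0 k))[p].
  by rewrite char0.
rewrite /exp_trunc mulr_sumr.
pose f i j := ((i`!%:R : F)^-1 *: X ^+ i) * ((j`!%:R : F)^-1 *: Y ^+ j).
transitivity (\sum_(0 <= k < n) \sum_(0 <= i < k.+1) f (k - i)%N i).
  apply: eq_big_nat => k _; rewrite exprDn_comm // big_mkord scaler_sumr.
  apply: eq_bigr => i _; rewrite /f -scalerAl -scalerAr scalerA.
  rewrite -scaler_nat scalerA; congr (_ *: _).
  have le_ik : (i <= k)%N by rewrite -ltnS.
  rewrite -(bin_fact le_ik) !natrM !invfM.
  have bin_neq0 : ('C(k, i)%:R : F) != 0.
    by move: (fact_neq0 k); rewrite -(bin_fact le_ik) natrM mulf_eq0; case/norP.
  by rewrite mulrAC mulVf // mul1r mulrC.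
rewrite big_nat_triangle; apply: eq_big_nat => i _.
(* In row [i] of the square, the terms with [n - i <= j] lie outside the triangle and vanish by
   [XY0]. *)
rewrite mulr_suml [RHS](@big_cat_nat _ _ _ (n - i)) ?leq_subr //=.
rewrite [X in _ + X]big_nat_cond [X in _ + X]big1 ?addr0 // => j.
rewrite andbT => /andP[le_nij _].
by rewrite -scalerAl -scalerAr XY0 ?scaler0 // addnC -leq_subLR.
Qed.

End TruncatedExp.

(** * Nilpotency and bijectivity of [exp1] *)

Section NilpotentAlgebra.
Variables (F : fieldType) (N : admissibleAlgType F).
Implicit Types x y z r u v w s : N.

Lemma nmulNl x y : nmul (- x) y = - nmul x y.
Proof. by rewrite -!lmultE linearN opp_lfunE. Qed.

Lemma nmulBl x y z : nmul (x - y) z = nmul x z - nmul y z.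
Proof. by rewrite nmulDl nmulNl. Qed.

Lemma ue_inj_iter x z k :
  ue_inj (iter k (nmul x) z) = ue_inj x ^+ k * ue_inj z.
Proof.
by elim: k => [|k IH]; rewrite ?mul1r //= ue_injM IH exprS mulrA.
Qed.

Lemma ue_inj_npow x k : ue_inj (npow x k.+1) = ue_inj x ^+ k.+1.
Proof. by rewrite /npow /= ue_inj_iter exprSr. Qed.

Lemma ue_injC x y : GRing.comm (ue_inj x) (ue_inj y).
Proof. by rewrite /GRing.comm -!ue_injM nmulC. Qed.

Lemma ue_inj_inj : injective (@ue_inj F N).
Proof. by move=> x y []. Qed.

Lemma ue_injD x y : ue_inj (x + y) = ue_inj x + ue_inj y.
Proof. by congr (_, _); rewrite /= addr0. Qed.

Lemma ue_injZ a x : ue_inj (a *: x) = a *: ue_inj x.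
Proof. by congr (_, _); rewrite /= scaler0. Qed.

(* The upper annihilator series: r N^m = 0. *)
Fixpoint upper_ann (m : nat) (r : N) : Prop :=
  if m is m'.+1 then forall y, upper_ann m' (nmul r y) else r = 0.

(** Nilpotency recast: the upper annihilator series exhausts [N], which permits induction on the
    level of an element. *)
Lemma upper_ann_total : exists n, forall x, upper_ann n x.
Proof.
have [n n0] := nilpotentN (s := N); exists n => x.
have {n0}: forall s : seq N, size s = n -> foldl (@nmul F N) x s = 0.
  by move=> s /n0.
elim: n x => [|n IH] x x0 /=; first exact: (x0 [::]).
by move=> y; apply: IH => s sz_s; apply: (x0 (y :: s)); rewrite /= sz_s.
Qed.

Lemma upper_ann0 m : upper_ann m 0.
Proof. by elim: m => //= m IH y; rewrite nmul0l. Qed.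

Lemma upper_annN m r : upper_ann m r -> upper_ann m (- r).
Proof.
elim: m r => [|m IH] r /= => [->|r0 y]; first by rewrite oppr0.
by rewrite nmulNl; apply: IH.
Qed.

Lemma upper_annM m r y : upper_ann m r -> upper_ann m.-1 (nmul y r).
Proof. by case: m => [->|m r0] /=; rewrite ?nmul0 // nmulC. Qed.

Lemma upper_ann_iter m r y k :
  upper_ann m r -> upper_ann (m - k) (iter k (nmul y) r).
Proof.
move=> r0; elim: k => [|k IH]; first by rewrite subn0.
by rewrite subnS /=; apply: upper_annM.
Qed.

(** Multiplication by [w] lowers the level by one, so a fixed point sinks to level 0. In unital
    terms, [1 - w] acts injectively on [N]. *)
Lemma nmul_fixed_eq0 w v : v = nmul w v -> v = 0.
Proof.
have [n n0] := upper_ann_total; have := n0 v.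
elim: n {n0} => [//|n IH] v0 fix_v; apply: IH => //.
by rewrite fix_v; apply: (upper_annM w v0).
Qed.

Lemma iter_nmul_eventually0 : exists n, forall x y z i j,
  (n <= i + j)%N -> iter i (nmul x) (iter j (nmul y) z) = 0.
Proof.
have [n n0] := upper_ann_total; exists n => x y z i j le_n.
have := upper_ann_iter x i (upper_ann_iter y j (n0 z)).
by rewrite -subnDA addnC (eqP le_n).
Qed.

Lemma expr_ue_inj_eventually0 : exists n, forall x y i j,
  (n <= i + j)%N -> ue_inj x ^+ i * ue_inj y ^+ j = 0.
Proof.
(* One factor has to serve as the starting value [z] of the iteration, hence [n.+1]. *)
have [n n0] := iter_nmul_eventually0; exists n.+1 => x y i [|j] le_n.
  case: i le_n => // i; rewrite addn0 => le_n.
  by rewrite mulr1 exprSr -ue_inj_iter (n0 x 0 x i 0) ?addn0.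
rewrite exprSr mulrA -mulrA -ue_inj_iter -ue_inj_iter n0 //.
by rewrite -ltnS -addnS.
Qed.

(** Moves the exponential to the unital extension, where [exp_truncD] applies. *)
Lemma nexpE n x : (forall k, (n.+1 <= k)%N -> ue_inj x ^+ k = 0) ->
  nexp x = exp_trunc n.+1 (ue_inj x).
Proof.
move=> n0; rewrite /nexp /exp_trunc big_nat_recl // expr0 invr1 scale1r.
congr (_ + _); rewrite (@exp1E _ _ _ n.+1) => [|[|k] // /n0].
  rewrite big_add1 /=.
  elim: (n) => [|m IH]; first by rewrite !big_geq.
  by rewrite !big_nat_recr //= ue_injD IH ue_injZ ue_inj_npow.
by rewrite -ue_inj_npow => /ue_inj_inj.
Qed.

(** The cofactor is [x/2! + x^2/3! + ...]. *)
Lemma exp1_factor x : exists w, exp1 x = x + nmul x w.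
Proof.
have [n n0] := upper_ann_total.
(* The bound [n.+1] would do for the vanishing; [n.+2] leaves a linear term to split off even if [n]
   is 0. *)
have pow0 k : (n.+2 <= k)%N -> npow x k = 0.
  case: k => // k /ltnW; rewrite ltnS -subn_eq0 => /eqP nk0.
  by have := upper_ann_iter x k (n0 x); rewrite nk0.
exists (\sum_(0 <= k < n) (k.+2`!%:R)^-1 *: npow x k.+1).
rewrite (exp1E pow0) big_add1 /= big_nat_recl // invr1 scale1r; congr (_ + _).
by rewrite linear_sum; apply: eq_bigr => k _; rewrite linearZ.
Qed.

Lemma exp1_ann a : a \in annihilator N -> exp1 a = a.
Proof.
by move=> /annihilatorP a0; have [w ->] := exp1_factor a; rewrite a0 addr0.
Qed.

Lemma exp1_eq0 x : exp1 x = 0 -> x = 0.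
Proof.
have [w ->] := exp1_factor x => /eqP; rewrite addr_eq0 => /eqP x_eq.
by apply: (@nmul_fixed_eq0 (- w)); rewrite nmulC linearN.
Qed.

Hypothesis char0 : [pchar F] =i pred0.

Lemma nexpD x y : nexp (x + y) = nexp x * nexp y.
Proof.
have [n n0] := expr_ue_inj_eventually0.
have n0' i j u v : (n.+1 <= i + j)%N -> ue_inj u ^+ i * ue_inj v ^+ j = 0.
  by move=> /ltnW; apply: n0.
have pow0 u k : (n.+1 <= k)%N -> ue_inj u ^+ k = 0.
  by move=> le_nk; rewrite -[LHS]mulr1 (n0' k 0%N u 0) ?addn0.
rewrite !(nexpE (pow0 _)) ue_injD exp_truncD //; first exact: ue_injC.
by move=> i j; apply: n0'.
Qed.

Lemma exp1D x y : exp1 (x + y) = exp1 x + exp1 y + nmul (exp1 x) (exp1 y).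
Proof.
apply: ue_inj_inj; apply: (@addrI _ 1); have := nexpD x y.
rewrite /nexp mulrDl mul1r mulrDr mulr1 => ->.
by rewrite !ue_injD ue_injM -!addrA; congr (_ + _); rewrite addrCA.
Qed.

(** For [e = exp1 (x - y)] the addition formula gives [(1 + exp1 y) e = 0], whence [e = 0]. *)
Lemma exp1_inj : injective (@exp1 F N).
Proof.
move=> x y exp_xy; apply/eqP; rewrite -subr_eq0; apply/eqP/exp1_eq0.
have := exp1D y (x - y); rewrite addrC subrK exp_xy -[LHS]addr0 -addrA.
move=> /addrI/esym/eqP; rewrite addr_eq0 => /eqP fix_e.
by apply: (@nmul_fixed_eq0 (- exp1 y)); rewrite nmulNl.
Qed.

(* Successive approximation: if u - exp1 s is in the m-th upper annihilator,
   replacing s by s + (u - exp1 s) moves the error into the (m-1)-th. *)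
Lemma exp1_surj u : exists s, exp1 s = u.
Proof.
have [n n0] := upper_ann_total.
suff /(_ n)[] : forall k, exists s, upper_ann (n - k) (u - exp1 s).
  by move=> s; rewrite subnn => /eqP; rewrite subr_eq0 => /eqP ->; exists s.
elim=> [|k [s]]; first by exists 0; rewrite subn0; apply: n0.
move def_r: (u - exp1 s) => r r0; exists (s + r); rewrite subnS exp1D.
have [w ->] := exp1_factor r.
(* The linear term of [exp1 r] cancels the error [r]; all that remains is a multiple of [r]. *)
have -> : u - (exp1 s + (r + nmul r w) + nmul (exp1 s) (r + nmul r w))
        = nmul (- (w + exp1 s + nmul (exp1 s) w)) r.
  rewrite nmulNl !nmulDl (nmulC w) -nmulA (nmulC w) nmulDr !opprD !addrA.
  by rewrite def_r subrr sub0r.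
exact: upper_annM.
Qed.

End NilpotentAlgebra.

(** * Admissible projections, and representing one by another *)

Section AdmissibleProjections.
Variables (F : fieldType) (N : admissibleAlgType F).
Implicit Types (x y r u v s a : N) (pi rho : 'End(N)).

Lemma admissible_projP pi :
  admissible_proj N pi <->
  (forall x, pi x \in annihilator N) /\
  (forall a, a \in annihilator N -> pi a = a).
Proof.
split=> [[pi_idem pi_im] | [pi_ann pi_id]].
  split=> [x | a]; rewrite -pi_im ?memv_img ?memvf // => /memv_imgP[x _ ->].
  by rewrite -[in LHS]comp_lfunE pi_idem.
split; first by apply/lfunP => x; rewrite comp_lfunE pi_id.
apply/vspaceP => a; apply/memv_imgP/idP => [[x _ ->] // | a_ann].
by exists a; rewrite ?memvf ?pi_id.
Qed.

Lemma alphaE pi s x : alpha pi s x = pi x + pi (nmul (exp1 s) x).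
Proof.
by rewrite comp_lfunE lfunE /= ue_mult_funE /= addr0 scale1r add0r linearD.
Qed.

Lemma admissible_alpha pi s :
  admissible_proj N pi -> admissible_proj N (alpha pi s).
Proof.
move=> /admissible_projP[pi_ann pi_id]; apply/admissible_projP; split=> [x | a].
  by rewrite alphaE rpredD.
move=> a_ann; rewrite alphaE nmulC (annihilatorP a a_ann).
by rewrite linear0 addr0 pi_id.
Qed.

(* The ideal generated by r would otherwise meet the annihilator, on which pi
   is the identity. *)
Lemma ideal_in_ker_eq0 pi r : admissible_proj N pi ->
  pi r = 0 -> (forall x, pi (nmul r x) = 0) -> r = 0.
Proof.
move=> /admissible_projP[_ pi_id]; have [n n0] := upper_ann_total N.
elim: n r {n0}(n0 r) => [//|n IH] r r_ann pi_r pi_rx.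
suff r_in : r \in annihilator N by rewrite -(pi_id r r_in).
(* Each [nmul r y] is one level lower and inherits both kernel conditions, so induction kills it. *)
apply/annihilatorP => y; apply: IH => // x.
by rewrite -nmulA.
Qed.

(** The mixed product vanishes and [exp1] fixes [- a]. *)
Lemma exp1_subr_ann x a : [pchar F] =i pred0 ->
  a \in annihilator N -> exp1 (x - a) = exp1 x - a.
Proof.
move=> char0 a_ann; have b_ann : - a \in annihilator N by rewrite rpredN.
by rewrite exp1D // (exp1_ann b_ann) nmulC (annihilatorP _ b_ann) addr0.
Qed.

(* As v - pi (exp1 v) lies in S_pi = S_rho, pi and rho agree on the range of
   exp1, which is all of N. *)
Lemma Spi_inj pi rho : [pchar F] =i pred0 ->
  admissible_proj N pi -> admissible_proj N rho -> Spi pi = Spi rho -> pi = rho.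
Proof.
move=> char0 /admissible_projP[pi_ann pi_id] /admissible_projP[_ rho_id] eqS.
apply/lfunP => u; have [v <-] := exp1_surj char0 u.
have : Spi pi (v - pi (exp1 v)).
  by rewrite /Spi /= exp1_subr_ann // linearB /= [pi (pi _)]pi_id ?subrr.
rewrite eqS /Spi /= exp1_subr_ann // linearB /= [rho (pi _)]rho_id // => /eqP.
by rewrite subr_eq0 eq_sym => /eqP.
Qed.

(* With annihilator F a0 and c the coordinate on it, the bilinear form
   (u, x) |-> c(pi (u x)) + c(pi u) c(pi x) is nondegenerate on all of N,
   whereas c(pi (u x)) alone is degenerate along a0. *)
Lemma proj_representable pi rho :
    admissible_proj N pi -> admissible_proj N rho ->
  exists2 u, pi u = 0 & forall x, rho x = pi x + pi (nmul u x).
Proof.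
move=> pi_adm rho_adm.
have [pi_ann pi_id] := (admissible_projP pi).1 pi_adm.
have [rho_ann rho_id] := (admissible_projP rho).1 rho_adm.
pose X := vbasis (annihilator N).
pose i0 := cast_ord (esym (dim_annihilator (s := N))) ord0.
pose a0 := X`_i0.
pose c : {linear N -> F^o} := coord X i0.
have a0_ann : a0 \in annihilator N.
  by apply/vbasis_mem/mem_nth; rewrite size_tuple.
have cK a : a \in annihilator N -> a = c a *: a0.
  move=> a_ann; rewrite [LHS](coord_vbasis a_ann) (bigD1 i0) //= big1 ?addr0 //.
  move=> i /eqP[]; apply/val_inj => /=; have := ltn_ord i.
  by rewrite [X in (i < X)%N](dim_annihilator (s := N)); case: (nat_of_ord i).
have c_a0 : c a0 = 1.
  by rewrite /c /= coord_free ?eqxx // (basis_free (vbasisP _)).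
pose T_fun u : 'Hom(N, F^o) :=
  linfun (c \o pi \o nmul u) + c (pi u) *: linfun (c \o pi).
have T_funE u x : T_fun u x = c (pi (nmul u x)) + c (pi u) * c (pi x).
  by rewrite add_lfunE scale_lfunE !lfunE.
have T_lin : linear T_fun.
  move=> k u v; apply/lfunP => x.
  rewrite T_funE [RHS]add_lfunE [X in _ = X + _]scale_lfunE !T_funE.
  rewrite nmulDl -nscaleAl !linearP.
  rewrite [in LHS]/= mulrDl scalerDr addrACA; congr (_ + _ + _).
  exact/esym/mulrA.
pose T_mix := GRing.isLinear.Build F N 'Hom(N, F^o) _ T_fun T_lin.
pose T_linear : {linear N -> 'Hom(N, F^o)} := HB.pack T_fun T_mix.
pose T := linfun T_linear.
have TE u x : T u x = c (pi (nmul u x)) + c (pi u) * c (pi x).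
  by rewrite lfunE /= T_funE.
have ann_nmul u : nmul u a0 = 0 by rewrite nmulC; apply/annihilatorP: u.
(* Evaluation at [a0] isolates the rank-one term; it serves both for injectivity of [T] and for
   [pi u = 0]. *)
have Ta0 u : T u a0 = c (pi u).
  by rewrite TE ann_nmul !linear0 add0r (pi_id a0) // c_a0 mulr1.
have T_inj : lker T == 0%VS.
  rewrite -subv0; apply/subvP => u; rewrite memv_ker memv0 => /eqP Tu0.
  have cu : c (pi u) = 0 by rewrite -Ta0 Tu0 lfunE.
  apply/eqP/(ideal_in_ker_eq0 pi_adm).
    by rewrite (cK _ (pi_ann u)) cu scale0r.
  move=> x; rewrite (cK _ (pi_ann _)); have := TE u x.
  by rewrite cu mul0r addr0 Tu0 lfunE /= => <-; rewrite scale0r.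
(* [N] and its dual have equal dimension, so injectivity suffices. *)
have T_surj : limg T = fullv.
  apply/eqP; rewrite eqEdim subvf limg_dim_eq ?(eqP T_inj) ?capv0 //.
  by rewrite !dimvf /dim /= muln1.
have /memv_imgP[u _ Tu] : linfun (c \o (rho - pi)) \in limg T.
  by rewrite T_surj memvf.
have TuE x : T u x = c (rho x) - c (pi x).
  by rewrite -Tu lfunE /= add_lfunE opp_lfunE linearB.
(* Both projections fix [a0], so the represented functional vanishes there. *)
have cu : c (pi u) = 0 by rewrite -Ta0 TuE (pi_id a0) // (rho_id a0) // subrr.
exists u => [|x]; first by rewrite (cK _ (pi_ann u)) cu scale0r.
rewrite (cK _ (rho_ann x)) [pi x](cK _ (pi_ann x)).
rewrite [pi (nmul u x)](cK _ (pi_ann _)).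
rewrite -scalerDl; congr (_ *: _); have := TuE x.
by rewrite TE cu mul0r addr0 => ->; rewrite addrC subrK.
Qed.

End AdmissibleProjections.

Theorem mainTheorem4 (F : fieldType) (char0 : [pchar F] =i pred0)
    (N : admissibleAlgType F) (pi : 'End(N)) (pi_adm : admissible_proj N pi) :
  [/\ set_bij (Spi pi) (admissible_proj N) (alpha pi),
      set_bij (admissible_proj N) (Sigma N) (@beta F N) &
      forall s : N, Spi pi s -> beta (alpha pi s) = [set x - s | x in Spi pi]].
Proof.
split; first split.
- by move=> s _; apply: admissible_alpha.
- move=> s t /set_mem Ss /set_mem St eq_st; apply: (exp1_inj char0).
  (* The element [exp1 s - exp1 t] and all its multiples lie in the kernel of [pi]. *)
  apply/eqP; rewrite -subr_eq0; apply/eqP/(ideal_in_ker_eq0 pi_adm).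
    by rewrite linearB /= Ss St subrr.
  move=> x; rewrite nmulBl linearB /=; apply/eqP; rewrite subr_eq0; apply/eqP.
  by apply: (@addrI _ (pi x)); rewrite -!alphaE eq_st.
(* The preimage is the logarithm of the representing element [u]; [pi u = 0] places it in
   [Spi pi]. *)
- move=> rho rho_adm; have [u pi_u rhoE] := proj_representable pi_adm rho_adm.
  have [s exp_s] := exp1_surj char0 u; exists s; first by rewrite /Spi /= exp_s.
  by apply/lfunP => x; rewrite alphaE exp_s.
- split; first by move=> rho rho_adm; exists rho.
    move=> rho1 rho2 /set_mem adm1 /set_mem adm2; exact: Spi_inj.
  by move=> _ [rho rho_adm <-]; exists rho.
- move=> s Ss.
  (* Here [exp(s) exp1(y) = exp1(s + y) - exp1(s)], and [pi] kills [exp1 s]. *)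
  have SE y : beta (alpha pi s) y <-> Spi pi (s + y).
    by rewrite /beta /Spi /= alphaE exp1D // !linearD /= Ss add0r.
  apply/seteqP; split=> [y /SE Sy | _ [x Sx <-]].
    by exists (s + y); rewrite // addrC addKr.
  by apply/SE; rewrite addrC subrK.
Qed.
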